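(* Let $G$ be a connected graph on $n$ vertices. The restriction of the resistance Laplacian $\mathcal R$ to $\mathbf 1^\perp$ is \[ \mathcal R|_{\mathbf 1^\perp}=2n\bar d\,I_{\mathbf 1^\perp}+2\,L^\dagger|_{\mathbf 1^\perp}+n\,(P\Delta P)|_{\mathbf 1^\perp}, \] where $I_{\mathbf 1^\perp}$ denotes the identity operator on $\mathbf 1^\perp$.
   Context: $G=(V,E)$ is a finite, simple, connected, undirected, unweighted graph with vertex set $V=\{1,\dots,n\}$. $L=D_G-A$ is its combinatorial Laplacian (degree matrix minus adjacency matrix). $\mathbf 1\in\mathbb R^n$ is the all-ones vector, $I$ the identity matrix, $J=\mathbf 1\mathbf 1^\top$, $P=I-\frac1n J$ (orthogonal projection onto $\mathbf 1^\perp$). $L^\dagger$ is the Moore--Penrose inverse of $L$, i.e. the unique symmetric matrix with $LL^\dagger=L^\dagger L=I-\frac1n\mathbf 1\mathbf 1^\top$ and $L^\dagger\mathbf 1=\mathbf 0$. The effective resistance is $r_{ij}=(L^\dagger)_{ii}+(L^\dagger)_{jj}-2(L^\dagger)_{ij}$, the resistance matrix is $R=(r_{ij})$, and the resistance Laplacian is $\mathcal R=\operatorname{diag}(R\mathbf 1)-R$. Put $d_i=(L^\dagger)_{ii}$, $D=\operatorname{diag}(d_1,\dots,d_n)$, $\bar d=\frac1n\operatorname{tr}(L^\dagger)$, $\Delta=D-\bar d I$. The subspace $\mathbf 1^\perp$ is invariant under $L^\dagger$, $\mathcal R$ and $P\Delta P$; restrictions are as operators $\mathbf 1^\perp\to\mathbf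 1^\perp$. *)

(* Defs.v *)
From HB Require Import structures.
From mathcomp Require Import all_boot all_order all_algebra.
Set Implicit Arguments.
Unset Strict Implicit.
Unset Printing Implicit Defensive.
Import Order.TTheory GRing.Theory Num.Theory.
Local Open Scope ring_scope.

Record sgraph (n : nat) := SGraph {
  adj :> rel 'I_n;
  adj_sym : symmetric adj;
  adj_irrefl : irreflexive adj }.

Definition connected_graph n (G : sgraph n) : Prop :=
  (0 < n)%N /\ forall i j : 'I_n, connect G i j.

Section MoorePenrose.
Variable K : realFieldType.

(* The four Penrose conditions. *)
Definition is_mpinv m n (A : 'M[K]_(m, n)) (X : 'M[K]_(n, m)) : bool :=
  [&& A *m X *m A == A, X *m A *m X == X,
      (A *m X)^T == A *m X & (X *m A)^T == X *m A].

Lemma is_mpinvP m n (A : 'M[K]_(m, n)) (X : 'M[K]_(n, m)) :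
  reflect [/\ A *m X *m A = A, X *m A *m X = X,
              (A *m X)^T = A *m X & (X *m A)^T = X *m A] (is_mpinv A X).
Proof.
by apply: (iffP and4P) => [[/eqP ? /eqP ? /eqP ? /eqP ?]|[? ? ? ?]];
  split=> //; apply/eqP.
Qed.

Lemma rowV_gram_eq0 n (u : 'rV[K]_n) : u *m u^T = 0 -> u = 0.
Proof.
move=> /matrixP/(_ 0 0); rewrite !mxE => h; apply/rowP => j; rewrite mxE.
have /eqP : \sum_i u 0 i ^+ 2 = 0.
  by rewrite -[RHS]h; apply: eq_bigr => i _; rewrite mxE expr2.
rewrite psumr_eq0 => [|i _]; last exact: sqr_ge0.
by move=> /allP/(_ j); rewrite mem_index_enum sqrf_eq0 => /(_ isT)/eqP.
Qed.

Lemma gram_unit m n (B : 'M[K]_(m, n)) : row_free B -> B *m B^T \in unitmx.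
Proof.
move=> Bfree; rewrite -row_free_unit; apply: inj_row_free => u uBB.
apply/eqP; rewrite -(mulmx_free_eq0 _ Bfree); apply/eqP/rowV_gram_eq0.
by rewrite trmx_mul mulmxA -(mulmxA u) uBB mul0mx.
Qed.

Lemma mpinv_exists m n (A : 'M[K]_(m, n)) : exists X, is_mpinv A X.
Proof.
have := mulmx_base A; move: (col_base_full A) (row_base_free A).
move: (\rank A) (col_base A) (row_base A) => r C F Cfull Ffree <-.
have uF : F *m F^T \in unitmx by exact: gram_unit.
have uC : C^T *m C \in unitmx.
  by rewrite -{2}[C]trmxK gram_unit // /row_free mxrank_tr.
pose Fr := F^T *m invmx (F *m F^T); pose Cl := invmx (C^T *m C) *m C^T.
have FFr : F *m Fr = 1%:M by rewrite mulmxA mulmxV.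
have ClC : Cl *m C = 1%:M by rewrite -mulmxA mulVmx.
have AX : C *m F *m (Fr *m Cl) = C *m Cl.
  by rewrite mulmxA -(mulmxA C) FFr mulmx1.
have XA : Fr *m Cl *m (C *m F) = Fr *m F.
  by rewrite mulmxA -(mulmxA Fr) ClC mulmx1.
exists (Fr *m Cl); apply/is_mpinvP; rewrite AX XA; split.
- by rewrite mulmxA -(mulmxA C) ClC mulmx1.
- by rewrite mulmxA -(mulmxA Fr) FFr mulmx1.
- by rewrite /Cl !trmx_mul trmx_inv trmx_mul !trmxK !mulmxA.
- by rewrite /Fr !trmx_mul trmx_inv trmx_mul !trmxK !mulmxA.
Qed.

Definition mpinv m n (A : 'M[K]_(m, n)) : 'M[K]_(n, m) :=
  xchoose (mpinv_exists A).

Lemma mpinvP m n (A : 'M[K]_(m, n)) : is_mpinv A (mpinv A).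
Proof. exact: xchooseP. Qed.

Lemma mpinv_uniq m n (A : 'M[K]_(m, n)) (X : 'M[K]_(n, m)) :
  is_mpinv A X -> X = mpinv A.
Proof.
move/is_mpinvP=> [AXA XAX AXs XAs].
have /is_mpinvP[AYA YAY AYs YAs] := mpinvP A; set Y := mpinv A in AYA YAY AYs YAs *.
have AXY : A *m X = A *m Y.
  transitivity ((A *m Y *m (A *m X))^T); first by rewrite mulmxA AYA AXs.
  by rewrite trmx_mul AXs AYs mulmxA AXA.
have XAY : X *m A = Y *m A.
  transitivity ((X *m A *m (Y *m A))^T).
    by rewrite -(mulmxA X) (mulmxA A) AYA XAs.
  by rewrite trmx_mul XAs YAs -(mulmxA Y) (mulmxA A) AXA.
by rewrite -XAX -mulmxA AXY mulmxA XAY YAY.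
Qed.

Lemma mpinv_sym n (A : 'M[K]_n) : A^T = A -> (mpinv A)^T = mpinv A.
Proof.
move=> As; have /is_mpinvP[AYA YAY AYs YAs] := mpinvP A.
apply/mpinv_uniq/is_mpinvP; set Y := mpinv A in AYA YAY AYs YAs *.
have AYt : A *m Y^T = Y *m A by rewrite -[RHS]YAs trmx_mul As.
have YtA : Y^T *m A = A *m Y by rewrite -[RHS]AYs trmx_mul As.
rewrite AYt YtA; split=> //.
- by rewrite -[RHS]As -[in RHS]AYA !trmx_mul As mulmxA AYt.
- by rewrite -[in RHS]YAY !trmx_mul As mulmxA YtA.
Qed.

Lemma mpinv_ker n p (A : 'M[K]_n) (x : 'M[K]_(n, p)) :
  A^T *m x = 0 -> mpinv A *m x = 0.
Proof.
move=> Ax; have /is_mpinvP[_ YAY AYs _] := mpinvP A.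
by rewrite -YAY -(mulmxA _ A) -AYs trmx_mul -!mulmxA Ax !mulmx0.
Qed.

End MoorePenrose.

Section GraphMatrices.
Variables (K : realFieldType) (n : nat).

Definition ones : 'cV[K]_n := const_mx 1.

Definition centering_mx : 'M[K]_n := 1%:M - n%:R^-1 *: (ones *m ones^T).

Variable G : sgraph n.

Definition adjacency_mx : 'M[K]_n := \matrix_(i, j) (G i j)%:R.

Definition degree_mx : 'M[K]_n := diag_mx (\row_i #|[set j | G i j]|%:R).

Definition laplacian_mx : 'M[K]_n := degree_mx - adjacency_mx.

Definition laplacian_pinv : 'M[K]_n := mpinv laplacian_mx.

Definition effective_resistance (i j : 'I_n) : K :=
  laplacian_pinv i i + laplacian_pinv j j - 2 * laplacian_pinv i j.

Definition resistance_mx : 'M[K]_n :=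
  \matrix_(i, j) effective_resistance i j.

Definition resistance_laplacian : 'M[K]_n :=
  diag_mx (resistance_mx *m ones)^T - resistance_mx.

Definition pinv_diag_mx : 'M[K]_n := diag_mx (\row_i laplacian_pinv i i).

Definition pinv_diag_mean : K := n%:R^-1 * \tr laplacian_pinv.

Definition pinv_diag_dev : 'M[K]_n := pinv_diag_mx - pinv_diag_mean%:M.

Definition compressed_diag_dev : 'M[K]_n :=
  centering_mx *m pinv_diag_dev *m centering_mx.

End GraphMatrices.

Section Restriction.
Variables (K : fieldType) (V : vectType K) (U : {vspace V}).

(* The operator induced on the invariant subspace U; by invariance the         *)
(* projection vsproj U only re-types values that already lie in U.             *)
Definition restrict_op (f : 'End(V)) (fU : (f @: U <= U)%VS) :
    'End(subvs_of U) :=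
  linfun (vsproj U \o f \o vsval).

Lemma restrict_opE (f : 'End(V)) (fU : (f @: U <= U)%VS) (u : subvs_of U) :
  vsval (restrict_op fU u) = f (vsval u).
Proof.
by rewrite lfunE /= vsprojK // (subvP fU) // memv_img // subvsP.
Qed.

End Restriction.

Section OnesPerp.
Variables (K : realFieldType) (n : nat).

Definition mx_op (M : 'M[K]_n) : 'End('cV[K]_n) := linfun (mulmx M).

(* The kernel of x |-> 1^T x. *)
Definition ones_perp : {vspace 'cV[K]_n} :=
  lker (linfun (mulmx (ones K n)^T) : 'Hom('cV[K]_n, 'M[K]_1)).

Lemma mx_op_inv (M : 'M[K]_n) :
  (ones K n)^T *m M = 0 -> (mx_op M @: ones_perp <= ones_perp)%VS.
Proof.
move=> M0; apply/subvP=> _ /memv_imgP[x _ ->].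
by rewrite memv_ker !lfunE /= mulmxA M0 mul0mx.
Qed.

Variable G : sgraph n.

Lemma laplacian_sym : (laplacian_mx K G)^T = laplacian_mx K G.
Proof.
rewrite linearB /= tr_diag_mx; congr (_ - _).
by apply/matrixP=> i j; rewrite !mxE adj_sym.
Qed.

Lemma degreeE i : #|[set j | G i j]|%:R = \sum_j (G i j)%:R :> K.
Proof.
rewrite -sum1_card natr_sum big_mkcond; apply: eq_bigr => j _.
by rewrite inE; case: (G i j).
Qed.

Lemma laplacian_ones : laplacian_mx K G *m ones K n = 0.
Proof.
apply/colP=> i; rewrite mulmxBl mul_diag_mx !mxE mulr1 degreeE.
by rewrite -sumrB big1 // => j _; rewrite !mxE mulr1 subrr.
Qed.

Lemma laplacian_pinv_sym : (laplacian_pinv K G)^T = laplacian_pinv K G.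
Proof. exact/mpinv_sym/laplacian_sym. Qed.

Lemma laplacian_pinv_ones : laplacian_pinv K G *m ones K n = 0.
Proof. by apply: mpinv_ker; rewrite laplacian_sym laplacian_ones. Qed.

Lemma ones_centering : (ones K n)^T *m centering_mx K n = 0.
Proof.
rewrite mulmxBr mulmx1 -scalemxAr mulmxA.
have -> : (ones K n)^T *m ones K n = n%:R%:M.
  apply/matrixP=> i j; rewrite !ord1 !mxE eqxx mulr1n.
  under eq_bigr do rewrite !mxE mulr1.
  by rewrite sumr_const card_ord.
rewrite mul_scalar_mx scalerA; case: (posnP n) => [n0|n_gt0].
  by apply/rowP=> j; have := ltn_ord j; rewrite [X in (_ < X)%N]n0.
by rewrite mulVf ?pnatr_eq0 -?lt0n // scale1r subrr.
Qed.

Lemma laplacian_pinv_inv :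
  (mx_op (laplacian_pinv K G) @: ones_perp <= ones_perp)%VS.
Proof.
apply: mx_op_inv; rewrite -laplacian_pinv_sym -trmx_mul.
by rewrite laplacian_pinv_ones trmx0.
Qed.

Lemma resistance_laplacian_inv :
  (mx_op (resistance_laplacian K G) @: ones_perp <= ones_perp)%VS.
Proof.
have Rs i j : effective_resistance K G i j = effective_resistance K G j i.
  rewrite /effective_resistance -[in laplacian_pinv K G i j]laplacian_pinv_sym.
  by rewrite mxE [laplacian_pinv K G i i + _]addrC.
apply: mx_op_inv; rewrite mulmxBr mul_mx_diag; apply/rowP=> j; rewrite !mxE.
rewrite mul1r -sumrB big1 // => i _.
by rewrite !mxE mul1r mulr1 Rs subrr.
Qed.

Lemma compressed_diag_dev_inv :
  (mx_op (compressed_diag_dev K G) @: ones_perp <= ones_perp)%VS.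
Proof. by apply: mx_op_inv; rewrite !mulmxA ones_centering !mul0mx. Qed.

End OnesPerp.

Section PinvCharacterization.
Variables (K : realFieldType) (n : nat) (G : sgraph n).

Lemma laplacian_ker (x : 'cV[K]_n) : connected_graph G ->
  laplacian_mx K G *m x = 0 -> forall i j, x i 0 = x j 0.
Proof.
move=> [_ Gc] Lx i j.
have Lxi k : \sum_l (G k l)%:R * (x k 0 - x l 0) = 0.
  have /colP/(_ k) := Lx; rewrite mulmxBl mul_diag_mx !mxE degreeE.
  apply: etrans; rewrite mulr_suml -sumrB; apply: eq_bigr => l _.
  by rewrite !mxE mulrBr.
pose S f := \sum_k \sum_l (G k l)%:R * f k l : K.
have S0 : S (fun k l => x k 0 * (x k 0 - x l 0)) = 0.
  apply: big1 => k _; apply: etrans (mulr0 (x k 0)).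
  rewrite -[in RHS](Lxi k) mulr_sumr.
  by apply: eq_bigr => l _; rewrite mulrCA.
have S1 : S (fun k l => x l 0 * (x l 0 - x k 0)) = 0.
  rewrite -[RHS]S0 [LHS]exchange_big; apply: eq_bigr => k _.
  by apply: eq_bigr => l _; rewrite adj_sym.
have : S (fun k l => (x k 0 - x l 0) ^+ 2) = 0.
  rewrite -[RHS]addr0 -[in X in _ = X + _]S0 -S1 /S -big_split /=.
  apply: eq_bigr => k _; rewrite -big_split; apply: eq_bigr => l _ /=.
  by rewrite -mulrDr -(opprB (x k 0)) mulrN -mulrBl -expr2.
have pos k l : 0 <= (G k l)%:R * (x k 0 - x l 0) ^+ 2.
  by rewrite mulr_ge0 ?ler0n ?sqr_ge0.
move/eqP; rewrite psumr_eq0 => [/allP Sk|k _]; last exact: sumr_ge0.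
have step k l : G k l -> x k 0 = x l 0.
  move=> Gkl; have := Sk k; rewrite mem_index_enum psumr_eq0 // => /(_ isT).
  move/allP/(_ l); rewrite mem_index_enum Gkl mul1r sqrf_eq0 subr_eq0.
  by move=> /(_ isT)/eqP.
have /connectP[p] := Gc i j.
by elim: p i => [|k p IHp] i /= => [_ -> //|/andP[/step -> /IHp]].
Qed.

(* For connected graphs the Moore-Penrose inverse of L is the unique symmetric *)
(* X with L X = X L = I - J/n and X 1 = 0.                                     *)
Lemma laplacian_pinvP (X : 'M[K]_n) : connected_graph G ->
  X = laplacian_pinv K G <->
  [/\ X^T = X, laplacian_mx K G *m X = centering_mx K n,
      X *m laplacian_mx K G = centering_mx K n & X *m ones K n = 0].
Proof.
move=> Gc; set L := laplacian_mx K G; set P := centering_mx K n.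
have Ls : L^T = L := laplacian_sym K G.
have L1 : L *m ones K n = 0 := laplacian_ones K G.
have Ps : P^T = P.
  by rewrite linearB /= linearZ /= trmx1 trmx_mul trmxK.
have MP (M : 'M[K]_n) : M *m ones K n = 0 -> M *m P = M.
  by move=> M1; rewrite mulmxBr mulmx1 -scalemxAr mulmxA M1 mul0mx scaler0 subr0.
have PM (M : 'M[K]_n) : M^T = M -> M *m ones K n = 0 -> P *m M = M.
  by move=> Ms M1; rewrite -[RHS]Ms -[in RHS](MP M) // trmx_mul Ms Ps.
split=> [->|[Xs LX XL X1]]; last first.
  apply/mpinv_uniq/is_mpinvP; rewrite LX XL; split=> //.
    by rewrite -/L PM.
  by rewrite PM.
have /is_mpinvP[LYL YLY LYs YLs] := mpinvP L.
rewrite -/(laplacian_pinv K G) in LYL YLY LYs YLs *.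
set Y := laplacian_pinv K G in LYL YLY LYs YLs *.
have Ys : Y^T = Y := laplacian_pinv_sym K G.
have Y1 : Y *m ones K n = 0 := laplacian_pinv_ones K G.
have YL : Y *m L = P.
  pose Q := 1%:M - Y *m L.
  have LQ : L *m Q = 0 by rewrite mulmxBr mulmx1 mulmxA LYL subrr.
  have Qs : Q^T = Q by rewrite linearB /= trmx1 YLs.
  have Qrow i k j : Q i j = Q k j.
    have := laplacian_ker Gc (x := col j Q) _ i k; rewrite !mxE; apply.
    by rewrite colE mulmxA -/L LQ mul0mx.
  have Qcol i j k : Q i j = Q i k by rewrite -Qs [LHS]mxE [RHS]mxE (Qrow j k).
  have Q1 : Q *m ones K n = ones K n.
    by rewrite mulmxBl mul1mx -mulmxA L1 mulmx0 subr0.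
  have n0 : n%:R != 0 :> K by rewrite pnatr_eq0 -lt0n; case: Gc.
  have Qn i j : n%:R * Q i j = 1.
    have /colP/(_ i) := Q1; rewrite [LHS]mxE [RHS]mxE; apply: etrans.
    under [in RHS]eq_bigr => k _ do rewrite [ones K n k 0]mxE mulr1 (Qcol i k j).
    by rewrite sumr_const card_ord mulr_natl.
  rewrite -[LHS](subKr 1%:M) -/Q; congr (_ - _); apply/matrixP=> i j.
  apply: (mulfI n0); rewrite Qn mxE mulrA divff // mul1r.
  by rewrite mxE big_ord1 !mxE mulr1.
split=> //; by rewrite -[LHS]trmxK trmx_mul Ys Ls YL Ps.
Qed.

End PinvCharacterization.

(* Main.v *)
Require Import Defs.
From mathcomp Require Import all_boot all_order all_algebra reals ring.
Import GRing.Theory Num.Theory.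
Local Open Scope ring_scope.

(** Write [Y] for the pseudoinverse of the Laplacian, [d] for the column of its
    diagonal entries, [m] for their mean and [Delta] for [diag d - m I].  The
    resistance matrix is [d 1^T + 1 d^T - 2 Y].  Since [Y 1 = 0], its row sums
    are [n d_i + n m], so that the diagonal part of the resistance Laplacian
    is [2 n m I + n Delta], and the resistance Laplacian is
      [2 n m I + 2 Y + n Delta - d 1^T - 1 d^T]
    (lemma [resistance_laplacianE]).

    On a vector [x] with [1^T x = 0] the term [d 1^T] vanishes.  The other
    rank-one term is exactly what compression removes from [n Delta]: as
    [P x = x] and [1^T Delta x = d^T x - m 1^T x = d^T x], one has
      [n P Delta P x = n Delta x - 1 1^T Delta x = n Delta x - 1 d^T x]
    (lemma [compressed_diag_dev_mulmx]).  Division by [n] is legitimate because a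
    connected graph is nonempty. *)

Section ResistanceLaplacian.
Variables (K : realFieldType) (n : nat) (G : sgraph n).

Local Notation Y := (laplacian_pinv K G).
Local Notation m := (pinv_diag_mean K G).
Local Notation Delta := (pinv_diag_dev K G).
Local Notation one := (ones K n).

Definition pinv_diag_col : 'cV[K]_n := \col_i Y i i.
Local Notation d := pinv_diag_col.

Lemma laplacian_pinv_row_sum i : \sum_j Y i j = 0.
Proof.
have /colP/(_ i) := laplacian_pinv_ones K G; rewrite !mxE => s0.
by rewrite -[RHS]s0; apply: eq_bigr => j _; rewrite [one j 0]mxE mulr1.
Qed.

(** Summing [Y_ii + Y_jj - 2 Y_ij] over [j]: the first term is constant, the
    second gives the trace, and the third vanishes because [Y 1 = 0]. *)
Lemma resistance_row_sum i : (0 < n)%N ->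
  (resistance_mx K G *m one) i 0 = n%:R * Y i i + n%:R * m.
Proof.
move=> n_gt0; have n0 : n%:R != 0 :> K by rewrite pnatr_eq0 -lt0n.
rewrite mxE; under eq_bigr do rewrite !mxE mulr1 /effective_resistance.
rewrite sumrB -mulr_sumr laplacian_pinv_row_sum mulr0 subr0 big_split /=.
by rewrite sumr_const card_ord mulr_natl /pinv_diag_mean mulVKf.
Qed.

(** The row sum [n d_i + n m] equals [2 n m + n (d_i - m)], which produces the
    scalar and the [Delta] terms; the other three come from the negated
    resistance matrix. *)
Lemma resistance_laplacianE : (0 < n)%N ->
  resistance_laplacian K G =
    (2 * n%:R * m)%:M + 2 *: Y + n%:R *: Delta - d *m one^T - one *m d^T.
Proof.
move=> n_gt0; apply/matrixP=> i j.
rewrite [in LHS]mxE [in LHS]mxE [in LHS]mxE resistance_row_sum //.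
rewrite !mxE !big_ord1 !mxE /effective_resistance mulr1 mul1r.
case: eqVneq => [<-|_]; rewrite ?mulr1n ?mulr0n; ring.
Qed.

Lemma centering_mulmxE (x : 'cV[K]_n) :
  centering_mx K n *m x = x - n%:R^-1 *: (one *m (one^T *m x)).
Proof. by rewrite mulmxBl mul1mx -scalemxAl -mulmxA. Qed.

Lemma ones_pinv_diag_dev : one^T *m Delta = d^T - m *: one^T.
Proof.
rewrite mulmxBr mul_mx_diag mul_mx_scalar; congr (_ - _).
by apply/rowP=> j; rewrite !mxE mul1r.
Qed.

(** The right factor [P] fixes [x]; the left one subtracts the mean of
    [Delta x], which is [d^T x / n] because the scalar part of [Delta]
    contributes a multiple of [1^T x = 0]. *)
Lemma compressed_diag_dev_mulmx (x : 'cV[K]_n) : one^T *m x = 0 ->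
  compressed_diag_dev K G *m x = Delta *m x - n%:R^-1 *: (one *m (d^T *m x)).
Proof.
move=> x0; rewrite -!mulmxA !centering_mulmxE x0 mulmx0 scaler0 subr0.
rewrite [one^T *m _]mulmxA ones_pinv_diag_dev (mulmxBl d^T).
by rewrite -scalemxAl x0 scaler0 subr0.
Qed.

Lemma resistance_laplacian_mulmx (x : 'cV[K]_n) : (0 < n)%N ->
  one^T *m x = 0 ->
  resistance_laplacian K G *m x =
    (2 * n%:R * m) *: x + 2 *: (Y *m x) +
    n%:R *: (compressed_diag_dev K G *m x).
Proof.
move=> n_gt0 x0; have n0 : n%:R != 0 :> K by rewrite pnatr_eq0 -lt0n.
rewrite resistance_laplacianE // compressed_diag_dev_mulmx //.
(* Delta unfolds to a difference, which distributivity would split. *)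
move: Delta => Dev; rewrite scalerBr scalerA mulfV // scale1r.
rewrite !mulmxBl !mulmxDl mul_scalar_mx -!scalemxAl -!mulmxA x0 mulmx0 subr0.
by rewrite addrA.
Qed.

End ResistanceLaplacian.

Theorem corollary2p11 (R : realType) (n : nat) (G : sgraph n)
    (Gconn : connected_graph G) :
  restrict_op (resistance_laplacian_inv R G) =
    (2 * n%:R * pinv_diag_mean R G) *: (\1%VF : 'End(subvs_of (ones_perp R n)))
    + 2 *: restrict_op (laplacian_pinv_inv R G)
    + n%:R *: restrict_op (compressed_diag_dev_inv R G).
Proof.
have [n_gt0 _] := Gconn.
apply/lfunP=> u; apply/val_inj.
have u0 : (ones R n)^T *m vsval u = 0.
  by have := subvsP u; rewrite memv_ker lfunE /= => /eqP.
rewrite !add_lfunE !scale_lfunE id_lfunE /=.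
by rewrite !restrict_opE !lfunE /= resistance_laplacian_mulmx.
Qed.
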